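(* For every integer $k\ge 0$ and every real $r\ge 0$, there exist $L,C\ge 1$ such that the following holds. If a graph $G$ admits a tree-decomposition $(T,(B_t:t\in V(T)))$ such that for each $t\in V(T)$, $B_t$ is the union of at most $k$ sets each with diameter at most $r$ in $G$, then $G$ admits an $(L,C)$-quasi-isometry to a graph with tree-width at most $k$.
   Context: Graphs may be infinite, and need not be connected. $\dist_G(u,v)$ is the number of edges in a shortest path of $G$ between $u,v$ ($\infty$ if there is none). The diameter of $X\subseteq V(G)$ in $G$ is the maximum of $\dist_G(u,v)$ over all $u,v\in X$ (distances are measured in $G$, not in $G[X]$). For $L,C\ge 0$, a map $\phi:V(G)\to V(H)$ is an $(L,C)$-quasi-isometry from $G$ to $H$ if: (i) for all $u,v\in V(G)$, if $\dist_G(u,v)$ is finite then $\dist_H(\phi(u),\phi(v))\le L\dist_G(u,v)+C$; (ii) for all $u,v\in V(G)$, if $\dist_H(\phi(u),\phi(v))$ is finite then $\dist_G(u,v)\le L\dist_H(\phi(u),\phi(v))+C$; (iii) for every $y\in V(H)$ there exists $v\in V(G)$ with $\dist_H(\phi(v),y)\le C$. ''$G$ admits an $(L,C)$-quasi-isometry to $H$'' means such a $\phi$ exists. A tree-decomposition of $G$ is a pair $(T,(B_t:t\in V(T)))$ where $T$ is a (possibly infinite) tree and each $B_t\subseteq V(G)$, such that $G$ is the union of the graphs $G[B_t]$ $(t\in V(T))$ and $B_{t_1}\cap B_{t_3}\subseteq B_{t_2}$ whenever $t_2$ lies on the path of $T$ between $t_1,t_3$. Its width is the maximum of $|B_t|-1$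 over $t\in V(T)$ (or $\infty$ if there is no finite maximum); the tree-width of $G$ is the minimum width of a tree-decomposition of $G$. *)

(* Defs.v *)
From mathcomp Require Import all_boot all_order all_algebra.
From mathcomp Require Import all_classical all_reals.
From mathcomp Require Import ereal counting_measure.
From Stdlib Require List.
Set Implicit Arguments.
Unset Strict Implicit.
Unset Printing Implicit Defensive.
Import Order.TTheory GRing.Theory Num.Theory.
Local Open Scope classical_set_scope.
Local Open Scope ring_scope.

(* Simple graphs, possibly infinite and possibly disconnected. *)
Record graph := Graph {
  vertex :> Type;
  adj : vertex -> vertex -> Prop;
  adj_sym : forall u v, adj u v -> adj v u;
  adj_irrefl : forall u, ~ adj u u
}.

(* [walk u p v]: the vertex sequence [u :: p] is a walk ending at [v];
   it has [size p] edges. *)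
Fixpoint walk (G : graph) (u : G) (p : seq G) (v : G) : Prop :=
  match p with
  | [::] => u = v
  | w :: q => adj u w /\ walk w q v
  end.

Definition is_path (G : graph) (u : G) (p : seq G) (v : G) : Prop :=
  walk u p v /\ List.NoDup (u :: p).

Definition connected_graph (G : graph) : Prop :=
  forall u v : G, exists p, is_path u p v.

(* A cycle is a path with at least three vertices whose ends are adjacent. *)
Definition acyclic (G : graph) : Prop :=
  forall (u v : G) (p : seq G),
    is_path u p v -> (2 <= size p)%N -> ~ adj v u.

Definition is_tree (G : graph) : Prop :=
  [/\ inhabited G, connected_graph G & acyclic G].

(* The infimum of the empty set is +oo; on a nonempty set of path lengths it
   is a minimum. *)
Definition dist (R : realType) (G : graph) (u v : G) : \bar R :=
  ereal_inf [set l | exists2 p, is_path u p v & l = (size p)%:R%:E].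

(* The empty set has diameter -oo, so it satisfies every bound. *)
Definition diameter (R : realType) (G : graph) (X : set G) : \bar R :=
  ereal_sup [set d | exists u v, [/\ X u, X v & d = dist R u v]].

Definition quasi_isometry (R : realType) (L C : R) (G H : graph)
    (phi : G -> H) : Prop :=
  [/\ forall u v : G, dist R u v \is a fin_num ->
        (dist R (phi u) (phi v) <= L%:E * dist R u v + C%:E)%E,
      forall u v : G, dist R (phi u) (phi v) \is a fin_num ->
        (dist R u v <= L%:E * dist R (phi u) (phi v) + C%:E)%E
    & forall y : H, exists v : G, (dist R (phi v) y <= C%:E)%E].

Record tree_decomposition (G : graph) := TreeDecomposition {
  td_tree : graph;
  td_bag : td_tree -> set G;
  td_is_tree : is_tree td_tree;
  td_vertices : forall v : G, exists t, td_bag t v;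
  td_edges : forall u v : G, adj u v -> exists t, td_bag t u /\ td_bag t v;
  td_inter : forall (t1 t2 t3 : td_tree) (p : seq td_tree),
    is_path t1 p t3 -> List.In t2 (t1 :: p) ->
    td_bag t1 `&` td_bag t3 `<=` td_bag t2
}.
Arguments td_bag {G} _ _.

(* [counting] is the cardinality, +oo on infinite sets; it asks for a
   [choiceType], which [{classic G}] provides on the vertex type. *)
Definition td_width (R : realType) (G : graph) (D : tree_decomposition G) :
    \bar R :=
  ereal_sup
    [set w | exists t, w = (@counting {classic G} R (td_bag D t) - 1)%E].

(* Widths lie in {-1, 0, 1, ..., +oo}, so the infimum is a minimum. *)
Definition treewidth (R : realType) (G : graph) : \bar R :=
  ereal_inf [set w | exists D : tree_decomposition G, w = td_width R D].

Definition union_of_small (R : realType) (G : graph) (k : nat) (r : R)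
    (B : set G) : Prop :=
  exists (m : nat) (X : 'I_m -> set G),
    [/\ (m <= k)%N, B = \bigcup_(i in setT) X i
      & forall i, (diameter R (X i) <= r%:E)%E].

(* Main.v *)
Require Import Defs.
From mathcomp Require Import all_boot all_order all_algebra.
From mathcomp Require Import all_classical all_reals.
From mathcomp Require Import finmap ereal counting_measure.
From mathcomp Require Import zify.
From Stdlib Require List Relation_Operators Operators_Properties.
Set Implicit Arguments.
Unset Strict Implicit.
Unset Printing Implicit Defensive.
Import Order.TTheory GRing.Theory Num.Theory.

(** Root the tree, and scan it downwards from the root. At every node some of
the vertices of the bag are pinned, and the pinned vertices are partitioned
into classes such that distinct classes are at distance more than r: there are
at most k of them, since each of the k small sets meets at most one class. A
vertex is covered by the classes that are born before it first appears and
whose center is close to it; once all its covers have died, it gets pinned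
itself, and joins a nearby class or starts a new one. When pinned vertices
bring classes together, the oldest of these absorbs the others. A class can
only grow when a still older class dies, which happens at most k times, so
classes have bounded diameter and a pinned vertex changes its class at most k
times. The covers of an unpinned vertex form a decreasing family, so that it
sees only classes close to each other as well.

The classes are the vertices of H. Two of them are adjacent when their centers
are close and they share a bag; the bags are the sets of at most k classes
alive at a node, with k intermediate bags on each edge of the tree, along
which the classes of the upper end are exchanged one by one for their heirs. *)

(** * Walks and distances *)

Section Walks.
Context (G : graph).
Implicit Types (u v w x : G) (p q : seq G).

Lemma walk_cat u p w q v : walk u p w -> walk w q v -> walk u (p ++ q) v.
Proof.
elim: p u => [|a p IH] u /=; first by move=> ->.
by move=> [ua wp] wq; split=> //; apply: IH.
Qed.

Lemma is_path_nil u : is_path u [::] u.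
Proof. by split=> //; apply: List.NoDup_cons => //; apply: List.NoDup_nil. Qed.

Lemma walk_end u p v : walk u p v -> List.In v (u :: p).
Proof.
elim: p u => [|a p IH] u /=; first by left.
by move=> [_ /IH] H; right.
Qed.

Lemma In_cat x p q : List.In x (p ++ q) <-> List.In x p \/ List.In x q.
Proof. by elim: p => [|a p IH] /=; [tauto|rewrite IH; tauto]. Qed.

Lemma NoDup_rcons p x : List.NoDup p -> ~ List.In x p -> List.NoDup (p ++ [:: x]).
Proof.
elim: p => [|a p IH] nd xp; first by constructor=> //; constructor.
move/List.NoDup_cons_iff: nd => [na nd]; constructor; last first.
  by apply: IH => // xp'; apply: xp; right.
by rewrite In_cat => -[//|/= [ax|//]]; apply: xp; left.
Qed.

Lemma walk_rev u p v : walk u p v ->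
  exists q, [/\ walk v q u, size q = size p,
    forall x, List.In x (v :: q) <-> List.In x (u :: p)
    & List.NoDup (u :: p) -> List.NoDup (v :: q)].
Proof.
elim: p u => [|a p IH] u.
  by move=> /= ->; exists [::]; split.
move=> [ua /IH [q [wq sq iq nq]]].
exists (q ++ [:: u]); split.
- by apply: walk_cat wq _; split=> //; apply: adj_sym.
- by rewrite size_cat sq addn1.
- move=> x; have -> : v :: q ++ [:: u] = (v :: q) ++ [:: u] by [].
  rewrite In_cat iq /=; tauto.
- move=> /List.NoDup_cons_iff [nu /nq nd].
  by apply: (@NoDup_rcons (v :: q)); [exact: nd|rewrite iq].
Qed.

Lemma path_split u p v x : is_path u p v -> List.In x (u :: p) ->
  exists q1 q2, [/\ is_path u q1 x, is_path x q2 v & p = q1 ++ q2].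
Proof.
elim: p u => [|a p IH] u [wp nd] xp.
  case: xp => // ux; subst x; rewrite /= in wp; subst v; exists [::], [::].
  by split=> //; apply: is_path_nil.
case: xp => [ux|xp].
  subst x; exists [::], (a :: p); split=> //.
  exact: is_path_nil.
case: wp => ua wp; move/List.NoDup_cons_iff: nd => [nu nd].
have [q1 [q2 [[w1 n1] P2 E]]] := IH a (conj wp nd) xp.
exists (a :: q1), q2; split=> //; last by rewrite E.
split; first by split.
constructor=> // uq; apply: nu; rewrite E.
by case: uq => [|uq]; [left|right; apply/In_cat; left].
Qed.

Lemma walk_path u p v : walk u p v ->
  exists q, [/\ is_path u q v, size q <= size p
    & forall x, List.In x (u :: q) -> List.In x (u :: p)].
Proof.
elim: p u => [|a p IH] u.
  by move=> /= ->; exists [::]; split=> //; apply: is_path_nil.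
move=> [ua /IH [q [Pq sq iq]]].
have [uq|uq] := pselect (List.In u (a :: q)).
  have [q1 [q2 [_ P2 E]]] := path_split Pq uq.
  exists q2; split=> //.
    by rewrite E size_cat in sq; rewrite /=; lia.
  move=> x [->|xq]; first by left.
  by right; apply: iq; right; rewrite E; apply/In_cat; right.
exists (a :: q); split=> //.
  by case: Pq => wq nq; split; [split|constructor].
by move=> x [->|xq]; [left|right; apply: iq].
Qed.

Definition nearby n u v := exists2 p, walk u p v & size p <= n.

Lemma nearby_refl n u : nearby n u u.
Proof. by exists [::]. Qed.

Lemma nearby_le m n u v : m <= n -> nearby m u v -> nearby n u v.
Proof. by move=> mn [p wp sp]; exists p => //; apply: leq_trans mn. Qed.

Lemma nearby_sym n u v : nearby n u v -> nearby n v u.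
Proof. by move=> [p /walk_rev [q [wq sq _ _]] sp]; exists q => //; rewrite sq. Qed.

Lemma nearby_trans m n u v w : nearby m u v -> nearby n v w -> nearby (m + n) u w.
Proof.
move=> [p wp sp] [q wq sq]; exists (p ++ q); first exact: walk_cat wq.
by rewrite size_cat leq_add.
Qed.

Lemma nearby_adj u v : adj u v -> nearby 1 u v.
Proof. by move=> uv; exists [:: v]. Qed.

Local Open Scope ring_scope.

Lemma nearby_dist_le (R : realType) n u v :
  nearby n u v -> (dist R u v <= n%:R%:E)%E.
Proof.
move=> [p /walk_path [q [Pq sq _]] sp].
apply: (@le_trans _ _ (size q)%:R%:E); first by apply: ereal_inf_lbound; exists q.
by rewrite lee_fin ler_nat (leq_trans sq).
Qed.

(** The strict margin [c < n%:R] yields a path of length below [n] without knowing that the infimum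
    is attained. *)
Lemma dist_le_nearby (R : realType) (c : R) n u v :
  (dist R u v <= c%:E)%E -> c < n%:R -> nearby n u v.
Proof.
move=> uv cn; have : (dist R u v < n%:R%:E)%E by apply: le_lt_trans uv _; rewrite lte_fin.
move=> /ereal_inf_lt [_ [p [wp _] ->]]; rewrite lte_fin ltr_nat => pn.
by exists p => //; apply: ltnW.
Qed.

Lemma dist_fin_num (R : realType) u v : dist R u v \is a fin_num ->
  exists2 n, dist R u v = n%:R%:E & nearby n u v.
Proof.
move=> fuv.
have H : exists n, `[< nearby n u v >].
  have fd : (dist R u v <= (fine (dist R u v))%:E)%E by rewrite fineK.
  have := archi_boundP (normr_ge0 (fine (dist R u v))) => bd.
  exists (Num.bound `|fine (dist R u v)|); apply/asboolP.
  by apply: dist_le_nearby fd _; apply: le_lt_trans bd; apply: ler_norm.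
case: (ex_minnP H) => n /asboolP nuv min.
exists n => //; apply/eqP; rewrite eq_le nearby_dist_le //=.
apply: le_ereal_inf_tmp => _ [p [wp _] ->]; rewrite lee_fin ler_nat.
by apply: min; apply/asboolP; exists p.
Qed.

End Walks.

(** * Rooted trees *)

Section Acyclic.
Context (T : graph) (Tac : acyclic T).
Implicit Types (u v a b : T) (p q : seq T).

(* Otherwise a path from a to b avoiding u would close up to a cycle through u. *)
Lemma acyclic_bridge u a b p :
  adj u a -> adj u b -> walk a p b -> ~ List.In u (a :: p) -> a = b.
Proof.
move=> ua ub /walk_path [q [[wq nq] _ iq]] up.
case: q wq nq iq => [//|c q] wq nq iq; exfalso.
apply: (Tac (u := u) (v := b) (p := a :: c :: q)) => //; last exact: adj_sym.
by split; [split|apply: List.NoDup_cons => // /iq].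
Qed.

Lemma acyclic_path_unique u p q v : is_path u p v -> is_path u q v -> p = q.
Proof.
elim: p u q => [|a p IH] u q [wp np] [wq nq].
  rewrite /= in wp; subst v; case: q wq nq => [//|b q] [_ wq].
  by move=> /List.NoDup_cons_iff [/(_ (walk_end wq))].
case: q wq nq => [wq|b q [ub wq] /List.NoDup_cons_iff [uq nq]].
  rewrite /= in wq; subst v; case: wp => _ wp.
  by move/List.NoDup_cons_iff: np => [/(_ (walk_end wp))].
case: wp => ua wp; move/List.NoDup_cons_iff: np => [up np].
have [r [wr _ ir _]] := walk_rev wq.
have ab : a = b.
  apply: (acyclic_bridge ua ub (walk_cat wp wr)) => ui.
  have : List.In u ((a :: p) ++ r) by [].
  rewrite In_cat => -[//|ur]; apply: uq; apply/ir; by right.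
subst b; congr cons; exact: (IH a q (conj wp np) (conj wq nq)).
Qed.

End Acyclic.

(** In the third clause, [m] is a node of least depth in [S]. From any other node of [S] the path to
    [m] begins with the parent, so convexity puts the parent in [S]. *)
Lemma tree_root (T : graph) : is_tree T ->
  exists (root : T) (par : T -> T) (dep : T -> nat),
  [/\ dep root = 0,
      forall t, t <> root -> dep t = (dep (par t)).+1
    & forall S : T -> Prop,
       (forall t1 t2 t3 p, is_path t1 p t3 -> List.In t2 (t1 :: p) ->
          S t1 -> S t3 -> S t2) ->
       (exists t, S t) ->
       exists2 m, S m & forall t, S t -> t <> m -> t <> root /\ S (par t)].
Proof.
move=> [[root] Tcon Tac].
have [rp rpP] := choice (fun t => Tcon t root).
pose par t := head root (rp t); pose dep t := size (rp t).
have rp0 : rp root = [::].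
  exact: (acyclic_path_unique Tac (rpP root) (is_path_nil root)).
have dep0 t : dep t = 0 -> t = root.
  by rewrite /dep; case: (rp t) (rpP t) => // -[].
have rpE t : t <> root -> [/\ rp t = par t :: rp (par t), adj t (par t)
    & ~ List.In t (par t :: rp (par t))].
  move=> tr; rewrite /par; case: (rp t) (rpP t) => [[/= /tr []]|a q].
  move=> [[ta wq] /List.NoDup_cons_iff [nt nq]] /=.
  by have -> : rp a = q by apply: (acyclic_path_unique Tac (rpP a)).
exists root, par, dep; split; first by rewrite /dep rp0.
  by move=> t /rpE [+ _ _]; rewrite /dep => ->.
move=> S Scv [t0 St0].
have Sex : exists n, `[< exists2 t, S t & dep t = n >].
  by exists (dep t0); apply/asboolP; exists t0.
case: (ex_minnP Sex) => n /asboolP [m Sm mn] nmin; exists m => // t St tm.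
have dmt : dep m <= dep t.
  by rewrite mn; apply: nmin; apply/asboolP; exists t.
have tr : t <> root.
  move=> tr; apply: tm; rewrite tr; apply/esym/dep0.
  by move: dmt; rewrite tr {2}/dep rp0 /= leqn0 => /eqP.
split=> //.
have [[|a p] [wp np]] := Tcon t m; first by [].
have [rt ta nt] := rpE _ tr.
case: wp => tA wp; move/List.NoDup_cons_iff: np => [tp np].
(* If [t] lay on the path from [m] to the root, it would be less deep than [m], against
   minimality. *)
have [trm|trm] := pselect (List.In t (m :: rp m)).
  have [q1 [q2 [P1 P2 E]]] := path_split (rpP m) trm.
  have E2 := acyclic_path_unique Tac (rpP t) P2.
  move: dmt; rewrite /dep E -E2 size_cat.
  case: q1 P1 {E} => [[/= mt]|? ? _]; first by case: tm.
  by rewrite /= addSn ltnNge leq_addl.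
have [r [wr _ ir _]] := walk_rev (rpP (par t)).1.
(* Continuing from [a] to [m], up to the root and back down to [par t] avoids [t], so [a] and
   [par t] are joined off [t]. *)
have <- : a = par t.
  apply: (acyclic_bridge Tac tA ta (walk_cat wp (walk_cat (rpP m).1 wr))).
  move=> ti; have : List.In t ((a :: p) ++ (rp m ++ r)) by [].
  rewrite !In_cat => -[//|[ti'|ti']]; first by apply: trm; right.
  by apply: nt; apply/ir; right.
by apply: (Scv t a m (a :: p)) => //; [split; [split|apply: List.NoDup_cons]|right; left].
Qed.

(** * Trees defined by a parent function *)

Section ParentGraph.
Context (N : Type) (root : N) (par : N -> N) (dep : N -> nat).
Hypothesis dep_par : forall n, n <> root -> dep n = (dep (par n)).+1.

Definition up_step a b := a <> root /\ par a = b.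

Lemma up_step_dep a b : up_step a b -> dep a = (dep b).+1.
Proof. by move=> [/dep_par -> ->]. Qed.

Lemma parent_adj_sym a b : up_step a b \/ up_step b a -> up_step b a \/ up_step a b.
Proof. by case; [right|left]. Qed.

Lemma parent_adj_irrefl a : ~ (up_step a a \/ up_step a a).
Proof. by move=> H; have : dep a = (dep a).+1 by [case: H => /up_step_dep]; lia. Qed.

Definition parent_graph := Graph parent_adj_sym parent_adj_irrefl.

Implicit Types (p q : seq parent_graph).

Lemma climb (S : N -> Prop) (m : N) :
  (forall n, S n -> n <> m -> n <> root /\ S (par n)) ->
  forall n, S n -> exists p, @walk parent_graph n p m /\ forall x, List.In x (n :: p) -> S x.
Proof.
move=> Sm n; have [d] := ubnP (dep n); elim: d n => [//|d IH] n nd Sn.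
have [nm|nm] := pselect (n = m).
  by exists [::]; split=> // x [<-|].
have [nr Sp] := Sm _ Sn nm.
have [|p [wp ip]] := IH (par n) _ Sp; first by move: nd; rewrite (dep_par nr).
exists (par n :: p); split; first by split=> //; left.
by move=> x [<-|/ip].
Qed.

(* After a step away from the root, every later step of a path leads away from the root. *)
Lemma descend (u w : parent_graph) p v : List.NoDup (u :: w :: p) ->
  walk w p v -> up_step w u -> dep v = dep u + (size p).+1.
Proof.
elim: p u w => [|x p IH] u w nd wp wu.
  by rewrite /= in wp; rewrite -wp (up_step_dep wu) addn1.
case: wp => wx wp; move/List.NoDup_cons_iff: nd => [nu nd].
case: wx => [wx|xw].
  case: nu; right; left; by rewrite -(proj2 wx) (proj2 wu).
by rewrite (IH _ _ nd wp xw) (up_step_dep wu) /=; lia.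
Qed.

(** The ends of a cycle's path are adjacent, so a first step away from the root, in either direction
    of traversal, contradicts the depth formula of [descend]. Otherwise both cycle neighbours of an
    end are its parent, hence coincide. *)
Lemma parent_graph_tree : is_tree parent_graph.
Proof.
split; first exact: inhabits root.
  move=> u v.
  have H n : exists p, @walk parent_graph n p root.
    have [||p [wp _]] := @climb (fun _ => True) root _ n; by [|exists p].
  have [p wp] := H u; have [q /walk_rev [q' [wq _ _ _]]] := H v.
  by have [r [Pr _ _]] := walk_path (walk_cat wp wq); exists r.
move=> u v [|w [|w2 p]] // [[uw wp] nd] _ vu.
have [[ur pu]|wu] := uw; last first.
  have := descend nd wp wu; case: vu => /up_step_dep ->; rewrite /=; lia.
case: vu => [vu|[_ vw]]; last first.
  move/List.NoDup_cons_iff: nd => [_ /List.NoDup_cons_iff [nw _]].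
  by apply: nw; rewrite -pu vw; apply: walk_end (proj2 wp).
have [[|b r] [wr sr _ /(_ nd) nr]] := walk_rev (conj uw wp : walk u [:: w, w2 & p] v).
  by [].
case: wr => vb wr; case: vb => [[_ vb]|bv].
  case: r wr nr sr => [//|c r] wr nr _.
  move/List.NoDup_cons_iff: nr => [_ /List.NoDup_cons_iff [nb _]].
  apply: nb; rewrite -vb (proj2 vu); exact: walk_end (proj2 wr).
have := descend nr wr bv; rewrite (up_step_dep vu); lia.
Qed.

(** Converse of the third clause of [tree_root]: the climbs from [t1] and [t3] to [m] stay in [S],
    and together they contain the only path between [t1] and [t3]. *)
Lemma parent_graph_convex (S : N -> Prop) (m : N) :
  (forall n, S n -> n <> m -> n <> root /\ S (par n)) ->
  forall (t1 t2 t3 : parent_graph) p, is_path t1 p t3 -> List.In t2 (t1 :: p) ->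
  S t1 -> S t3 -> S t2.
Proof.
move=> Sm t1 t2 t3 p Pp tp S1 S3.
have [p1 [w1 i1]] := climb Sm S1; have [p3 [w3 i3]] := climb Sm S3.
have [q [wq _ iq _]] := walk_rev w3.
have [r [Pr _ ir]] := walk_path (walk_cat w1 wq).
have [_ _ Tac] := parent_graph_tree.
move: tp; rewrite (acyclic_path_unique Tac Pp Pr) => /ir.
rewrite -/((t1 :: p1) ++ q) In_cat => -[/i1//|tq].
by apply: i3; apply/iq; right.
Qed.

End ParentGraph.

(** * Classes of pinned vertices *)

(** Once [P] is inhabited the choice depends on [P] alone and not on [d]; hence connected vertices
    select the same class. *)
Definition witness (X : Type) (d : X) (P : X -> Prop) : X :=
  if pselect (exists x, P x) is left h then projT1 (cid h) else d.

Lemma witnessP (X : Type) (d : X) (P : X -> Prop) : (exists x, P x) -> P (witness d P).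
Proof. by rewrite /witness => h; case: pselect => // h'; case: cid. Qed.

Lemma witness_ext (X : Type) (d d' : X) (P P' : X -> Prop) :
  (forall x, P x <-> P' x) -> (exists x, P x) -> witness d P = witness d' P'.
Proof.
move=> E; have -> : P = P' by apply/funext => x; apply/propext.
by rewrite /witness => h; case: pselect.
Qed.

(** * Cardinality capped at [k] *)

Section CountUpTo.
Context (X : Type) (k : nat).
Implicit Types A : X -> Prop.

Definition at_least A n := exists f : 'I_n -> X, injective f /\ forall i, A (f i).

Definition count_upto A := \max_(n < k.+1 | `[< at_least A n >]) (n : nat).

Lemma count_upto_le A : count_upto A <= k.
Proof. by apply/bigmax_leqP => i _; rewrite -ltnS. Qed.

Lemma count_uptoP A : at_least A (count_upto A).
Proof.
have H0 : @ord0 k \in [pred n : 'I_k.+1 | `[< at_least A n >]].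
  change (`[< at_least A (@ord0 k) >]); apply/asboolP.
  have F (i : 'I_0) : False by case: i.
  exists (fun i : 'I_0 => match F i with end); by split=> i; case: (F i).
have [|i iA E] := @eq_bigmax_cond _ [pred n : 'I_k.+1 | `[< at_least A n >]] (fun i => i : nat).
  by apply/card_gt0P; exists ord0.
have {}iA : `[< at_least A i >] := iA.
by move/asboolP: iA; rewrite /count_upto -E.
Qed.

Lemma count_upto_ge A n : n <= k -> at_least A n -> n <= count_upto A.
Proof.
rewrite -ltnS => nk An.
by apply: (@leq_bigmax_cond _ _ (fun i : 'I_k.+1 => i : nat) (Ordinal nk)); apply/asboolP.
Qed.

Lemma at_least_sub A A' n : (forall x, A x -> A' x) -> at_least A n -> at_least A' n.
Proof. by move=> s [f [fi Af]]; exists f; split=> // i; apply: s. Qed.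

Lemma count_upto_sub A A' : (forall x, A x -> A' x) -> count_upto A <= count_upto A'.
Proof.
move=> s; apply: count_upto_ge; first exact: count_upto_le.
exact: at_least_sub s (count_uptoP A).
Qed.

(** Strictness requires that [A'] have at most [k] elements: otherwise the cap could hide the extra
    element [y]. *)
Lemma count_upto_lt A A' y : (forall n, at_least A' n -> n <= k) ->
  (forall x, A x -> A' x) -> A' y -> ~ A y -> count_upto A < count_upto A'.
Proof.
move=> bd s Ay nAy; have [f [fi Af]] := count_uptoP A.
have H : at_least A' (count_upto A).+1.
  exists (fun i => if unlift ord0 i is Some j then f j else y); split.
    move=> i j; case: unliftP => [i'|] ->; case: unliftP => [j'|] -> //.
    - by move=> /fi ->.
    - by move=> E; case: nAy; rewrite -E.
    - by move=> E; case: nAy; rewrite E.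
  by move=> i; case: unliftP => // j _; apply: s.
by apply: count_upto_ge => //; apply: bd.
Qed.

End CountUpTo.

(** * The downward scan of the rooted tree *)

Section Process.
Context (G : graph) (T : Type) (root : T) (par : T -> T) (dep : T -> nat).
Context (k r : nat) (B : T -> G -> Prop) (ball : T -> 'I_k -> G -> Prop).
Context (top : G -> T).
Hypothesis dep_root : dep root = 0.
Hypothesis dep_par : forall t, t <> root -> dep t = (dep (par t)).+1.
Hypothesis ballP : forall t v, B t v <-> exists i, ball t i v.
Hypothesis ball_nearby : forall t i u v, ball t i u -> ball t i v -> nearby r u v.
Hypothesis B_top : forall v, B (top v) v.
Hypothesis B_par : forall t v, B t v -> t <> top v -> t <> root /\ B (par t) v.

(* A class is named by the node of its birth and its center. *)
Notation class := (T * G)%type.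
Implicit Types (t s : T) (u v w x y q : G) (X Y Z W : class).

Definition age X := dep X.1.

Definition spread c := r + k * (c + r).

(* [radius j] bounds the extent of a class that has grown at most j times. *)
Fixpoint radius j := if j is j'.+1 then
  spread (r + (radius j' + radius j')) + radius j' else spread r.

(** A vertex within [r] of a member of a class is this close to its center, so the class fails to
    cover it only by being born too late. *)
Definition cover_radius := r + radius k.

Section Step.
Context (t : T) (pre : G -> class -> Prop).

Definition old q X := B t q /\ pre q X.
Definition alive X := exists q, old q X.
Definition covers X v :=
  [/\ alive X, age X < dep (top v) & nearby cover_radius v X.2].
Definition fresh v :=
  [/\ B t v, ~ (exists X, pre v X) & ~ (exists X, covers X v)].
Definition pinned v := (exists X, old v X) \/ fresh v.
Definition link x y := [/\ pinned x, pinned y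
  & nearby r x y \/ exists X, old x X /\ old y X].
Definition conn := Relation_Operators.clos_refl_trans G link.
Definition in_comp x X := exists2 y, conn x y & old y X.
Definition oldest x X := in_comp x X /\ forall Y, in_comp x Y -> age X <= age Y.
(** A component containing old classes passes to one of the oldest of them; a component without any
    founds a class born at [t]. *)
Definition new_class x : class :=
  if pselect (exists X, in_comp x X) then witness (t, x) (oldest x)
  else (t, witness x (conn x)).
Definition step x X := pinned x /\ X = new_class x.
End Step.

(** The scan recurses on the depth, [T] being no inductive type; at depth 0 nothing is inherited. *)
Fixpoint state_at n t : G -> class -> Prop :=
  step t (if n is n'.+1 then state_at n' (par t) else fun _ _ => False).
Definition state t := state_at (dep t) t.
Definition pre t := if dep t is n.+1 then state_at n (par t) else fun _ _ => False.

Lemma stateE t : state t = step t (pre t).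
Proof. by rewrite /state /pre; case: (dep t). Qed.

Lemma pre_par t : t <> root -> pre t = state (par t).
Proof. by move=> tr; rewrite /pre (dep_par tr). Qed.

Lemma pre_root q X : ~ pre root q X.
Proof. by rewrite /pre dep_root. Qed.

Notation old_ t := (old t (pre t)).
Notation alive_ t := (alive t (pre t)).
Notation covers_ t := (covers t (pre t)).
Notation fresh_ t := (fresh t (pre t)).
Notation pinned_ t := (pinned t (pre t)).
Notation conn_ t := (conn t (pre t)).
Notation in_comp_ t := (in_comp t (pre t)).
Notation new_ t := (new_class t (pre t)).

Lemma state_new t q X : state t q X <-> pinned_ t q /\ X = new_ t q.
Proof. by rewrite stateE. Qed.

Lemma state_fun t q X Y : state t q X -> state t q Y -> X = Y.
Proof. by move=> /state_new[_ ->] /state_new[_ ->]. Qed.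

Lemma pinned_B t q : pinned_ t q -> B t q.
Proof. by case=> [[X []]|[]]. Qed.

Lemma state_B t q X : state t q X -> B t q.
Proof. by move=> /state_new [/pinned_B]. Qed.

Lemma old_root t q X : old_ t q X -> t <> root.
Proof. by move=> [_ pq] tr; move: pq; rewrite tr => /pre_root. Qed.

Lemma old_state t q X : old_ t q X -> state (par t) q X.
Proof. by move=> o; rewrite -pre_par; [case: o|apply: old_root o]. Qed.

Lemma old_fun t q X Y : old_ t q X -> old_ t q Y -> X = Y.
Proof. by move=> /old_state + /old_state; apply: state_fun. Qed.

Lemma dep_top t v : B t v -> dep (top v) <= dep t /\ (t <> top v -> dep (top v) < dep t).
Proof.
have [n] := ubnP (dep t); elim: n t => // n IH t tn Bt.
have [->|tv] := pselect (t = top v); first by split.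
have [tr Bp] := B_par Bt tv; rewrite (dep_par tr) in tn *.
have [H _] := IH _ tn Bp; split=> [|_]; lia.
Qed.

Lemma conn_sym t pr x y : conn t pr x y -> conn t pr y x.
Proof.
elim=> [{}x {}y [px py xy]|{}x|{}x {}y z _ yx _ zy].
- apply: Relation_Operators.rt_step; split=> //.
  by case: xy => [/nearby_sym|[X []]]; [left|right; exists X].
- exact: Relation_Operators.rt_refl.
- exact: Relation_Operators.rt_trans zy yx.
Qed.

Lemma conn_new t pr x y : conn t pr x y -> new_class t pr x = new_class t pr y.
Proof.
move=> xy.
have cE z : conn t pr x z <-> conn t pr y z.
  split; apply: Relation_Operators.rt_trans => //; exact: conn_sym.
have iE X : in_comp t pr x X <-> in_comp t pr y X.
  by split=> -[z /cE]; exists z.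
have oE X : oldest t pr x X <-> oldest t pr y X.
  by split=> -[/iE ? H]; split=> // Y /iE; apply: H.
rewrite /new_class; case: pselect => [[X iX]|nx]; case: pselect => [[Y iY]|ny].
- apply: witness_ext => //; have : exists n, `[< exists2 Z, in_comp t pr x Z & age Z = n >].
    by exists (age X); apply/asboolP; exists X.
  move=> ex; case: (ex_minnP ex) => n /asboolP [Z iZ <-] min.
  by exists Z; split=> // Z' iZ'; apply: min; apply/asboolP; exists Z'.
- by case: ny; exists X; apply/iE.
- by case: nx; exists Y; apply/iE.
- congr pair; apply: witness_ext => //; exists x; exact: Relation_Operators.rt_refl.
Qed.

Lemma new_classP t pr x : let X := new_class t pr x in
  (oldest t pr x X) \/
  [/\ X.1 = t, conn t pr x X.2 & ~ exists Y, in_comp t pr x Y].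
Proof.
rewrite /= /new_class; case: pselect => [[X iX]|nx]; [left|right].
  apply: witnessP; have : exists n, `[< exists2 Z, in_comp t pr x Z & age Z = n >].
    by exists (age X); apply/asboolP; exists X.
  move=> ex; case: (ex_minnP ex) => n /asboolP [Z iZ <-] min.
  by exists Z; split=> // Z' iZ'; apply: min; apply/asboolP; exists Z'.
split=> //=; apply: (@witnessP _ x (conn t pr x)); exists x.
exact: Relation_Operators.rt_refl.
Qed.

Lemma state_birth t q X : state t q X -> alive_ t X \/ X.1 = t.
Proof.
move=> /state_new [_ ->]; case: (new_classP t (pre t) q) => [[[y _ oy] _]|[]]; last by right.
by left; exists y.
Qed.

Lemma age_le t q X : state t q X -> age X <= dep t.
Proof.
have [n] := ubnP (dep t); elim: n t q => // n IH t q tn /state_birth [[y oy]|]; last first.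
  by rewrite /age => ->.
have tr := old_root oy; rewrite (dep_par tr) in tn *.
by apply: leqW; apply: IH (old_state oy).
Qed.

Lemma age_alive t X : alive_ t X -> age X < dep t.
Proof.
move=> [q oq]; have tr := old_root oq; rewrite (dep_par tr) ltnS.
exact: age_le (old_state oq).
Qed.

Lemma state_separated t u v X Y : state t u X -> state t v Y -> nearby r u v -> X = Y.
Proof.
move=> /state_new [pu ->] /state_new [pv ->] uv; apply: conn_new.
by apply: Relation_Operators.rt_step; split=> //; left.
Qed.

Lemma old_separated t u v X Y : old_ t u X -> old_ t v Y -> nearby r u v -> X = Y.
Proof. by move=> /old_state + /old_state; apply: state_separated. Qed.

(** Sending each class to a ball that contains one of its vertices is injective, since two vertices
    in one ball are within [r]. *)
Lemma separated_at_least t (S : G -> class -> Prop) n :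
  (forall u v X Y, S u X -> S v Y -> nearby r u v -> X = Y) ->
  (forall u X, S u X -> B t u) ->
  at_least (fun X => exists u, S u X) n -> n <= k.
Proof.
move=> sep SB [f [fi Sf]].
have [u Su] := choice Sf.
have /choice [g gP] : forall i, exists j, ball t j (u i).
  by move=> i; apply/ballP; apply: SB (Su i).
have gi : injective g.
  move=> i j gij; apply: fi; apply: sep (Su i) (Su j) _.
  by apply: ball_nearby (gP i) _; rewrite gij.
by have := leq_card g gi; rewrite !card_ord.
Qed.

Lemma alive_at_least t n : at_least (alive_ t) n -> n <= k.
Proof. exact: (@separated_at_least t (old_ t) n (@old_separated t) (fun u X o => proj1 o)). Qed.

(** * Ranks and the extent of classes *)

Definition older t X W := alive_ t W /\ age W < age X.
(** The potential of the argument: it never increases down the tree while [X] lives, and drops when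
    an older class dies. *)
Definition rank t X := count_upto k (older t X).

Lemma rank_le t X : rank t X <= k.
Proof. exact: count_upto_le. Qed.

Lemma rank_age t X Y : age X <= age Y -> rank t X <= rank t Y.
Proof. by move=> XY; apply: count_upto_sub => W [aW WX]; split=> //; apply: leq_trans XY. Qed.

(** As [X] is born at depth at most that of [par t], the older [W] cannot be born at [par t], so it
    was inherited there. *)
Lemma alive_par t W X : alive_ t W -> alive_ t X -> age W < age X -> alive_ (par t) W.
Proof.
move=> [q oq] [q' oq'] WX; have [//|W1] := state_birth (old_state oq).
by have := age_le (old_state oq'); move: WX; rewrite /age W1; lia.
Qed.

Lemma rank_par t X : alive_ t X -> rank t X <= rank (par t) X.
Proof.
move=> aX; apply: count_upto_sub => W [aW WX]; split=> //.
exact: alive_par aW aX WX.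
Qed.

Lemma rank_par_lt t X W : alive_ t X -> alive_ (par t) W -> age W < age X ->
  ~ alive_ t W -> rank t X < rank (par t) X.
Proof.
move=> aX aW WX nW; apply: (@count_upto_lt _ _ _ _ W) => //; last by case.
  move=> n /(at_least_sub (A' := alive_ (par t))) H.
  by apply: (@alive_at_least (par t)); apply: H => ? [].
move=> Z [aZ ZX]; split=> //; exact: alive_par aZ aX ZX.
Qed.

(** Links induce a graph on the [k] balls. A simple path in it has fewer than [k] edges, each
    costing one link and one crossing of a ball. *)
Lemma spread_bound t pr c x y :
  (forall a b, conn t pr x a -> link t pr a b -> nearby c a b) ->
  (forall q, pinned t pr q -> B t q) ->
  pinned t pr x -> conn t pr x y -> nearby (spread c) x y.
Proof.
move=> lk pB px xy.
pose e : rel 'I_k := fun i j => `[< exists a b, [/\ ball t i a, ball t j b & nearby c a b] >].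
have [i xi] := (ballP t x).1 (pB _ px).
have [j yj ij] : exists2 j, ball t j y & connect e i j.
  have := Operators_Properties.clos_rt_rtn1 _ _ _ _ xy.
  elim=> [|y' z yz xy' [j yj ij]]; first by exists i.
  have xy2 := Operators_Properties.clos_rtn1_rt _ _ _ _ xy'.
  have [_ pz _] := yz; have [j' zj'] := (ballP t z).1 (pB _ pz).
  exists j' => //; apply: connect_trans ij _; apply: connect1.
  by apply/asboolP; exists y', z; split=> //; apply: lk.
have [p ep jE] := connectP ij.
case/shortenP: ep jE => p' ep' up' _ jE.
have sp : size p' < k by have := max_card (mem (i :: p')); rewrite (card_uniqP up') card_ord.
have H : nearby (r + size p' * (c + r)) x y.
  move: jE ep' xi {up' sp xy px lk ij}; elim: p' i x => [|i' p' IH] i x /=.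
    by move=> ji _ xi; rewrite mul0n addn0; apply: ball_nearby xi _; rewrite -ji.
  move=> jE /andP [/asboolP [a [b [ai bi ab]]] ep'] xi.
  have -> : r + (size p').+1 * (c + r) = r + (c + (r + size p' * (c + r))) by lia.
  apply: nearby_trans (ball_nearby xi ai) _; apply: nearby_trans ab _; exact: IH bi.
apply: nearby_le H; rewrite leq_add2l leq_mul2r ltnW ?orbT //.
Qed.

Lemma radius_le i j : i <= j -> radius i <= radius j.
Proof.
elim: j => [|j IH]; first by rewrite leqn0 => /eqP ->.
rewrite leq_eqVlt => /orP [/eqP -> //|/IH H]; apply: leq_trans H _.
exact: leq_addl.
Qed.

(* A vertex only becomes pinned next to an older surviving class when its own
   covers die; those are even older, so the rank of the class drops. *)
Lemma join_drops t x q X :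
  (forall q X, state (par t) q X -> nearby (radius k) q X.2) ->
  fresh_ t x -> old_ t q X -> nearby r x q ->
  exists W, [/\ alive_ (par t) W, age W < age X & ~ alive_ t W].
Proof.
move=> rad [Bx np nc] oq xq; have tr := old_root oq.
have nX : nearby cover_radius x X.2 := nearby_trans xq (rad _ _ (old_state oq)).
have aX : alive_ t X by exists q.
have topX : dep (top x) <= age X.
  by rewrite leqNgt; apply/negP => H; apply: nc; exists X.
have tx : t <> top x.
  by move=> tx; have := age_alive aX; rewrite ltnNge {1}tx topX.
have [_ Bp] := B_par Bx tx.
have ps : ~ pinned_ (par t) x.
  by move=> px; apply: np; exists (new_ (par t) x); rewrite pre_par // state_new.
have [W cW] : exists W, covers_ (par t) W x.
  apply: contrapT => nW; apply: (ps); right; split=> // -[W pW].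
  by apply: ps; left; exists W.
have [aW W_top nW] := cW.
exists W; split=> //; first exact: leq_trans topX.
by move=> aW'; apply: nc; exists W.
Qed.

(** Starting in [X], a link to another old vertex stays in [X] by separation, and a link to a fresh
    vertex is excluded. *)
Lemma comp_pure t q y X :
  (forall x q, fresh_ t x -> old_ t q X -> ~ nearby r x q) ->
  old_ t q X -> conn_ t q y -> old_ t y X.
Proof.
move=> nf oq qy; have := Operators_Properties.clos_rt_rtn1 _ _ _ _ qy.
elim=> // y' z [_ pz yz] _ oy; case: yz => [yz|[Z [oZ oZ']]].
  case: pz => [[Z oz]|fz]; last by case: (nf _ _ fz oy); apply: nearby_sym.
  by rewrite (old_separated oy oz yz).
by rewrite (old_fun oy oZ).
Qed.

(** Induction on depth with three cases: the class is newborn, it grows next to a fresh vertex and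
    its rank has dropped, or its members at [t] were members before. *)
Lemma state_rank_radius t q X : state t q X -> nearby (radius (k - rank t X)) q X.2.
Proof.
have [n] := ubnP (dep t); elim: n t q X => // n IH t y Y tn sY.
have IHp q X : t <> root -> state (par t) q X ->
    nearby (radius (k - rank (par t) X)) q X.2.
  by move=> tr; apply: IH; rewrite (dep_par tr) in tn.
have [py YE] := (state_new _ _ _).1 sY.
have [|[_ yY no]] := new_classP t (pre t) y; rewrite -?YE; last first.
  apply: (@nearby_le _ (radius 0)); first exact: radius_le.
  apply: (@spread_bound t (pre t)) py _ => //; last by rewrite YE.
    move=> a b ya [_ _ [//|[X [oa _]]]]; case: no; exists X; by exists a.
  exact: pinned_B.
move=> [[z yz oz] min]; have tr := old_root oz.
have aY : alive_ t Y by exists z.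
have [[x [q [fx oq xq]]]|nx] := pselect (exists x q, [/\ fresh_ t x, old_ t q Y & nearby r x q]).
  have [|W [aW WY nW]] := join_drops _ fx oq xq.
    move=> q' X' sX'; apply: nearby_le (IHp _ _ tr sX'); apply: radius_le.
    exact: leq_subr.
  have lt := rank_par_lt aY aW WY nW.
  set R := radius (k - rank (par t) Y).
  (* The drop in rank pays for one more unfolding of [radius]. *)
  apply: (@nearby_le _ (radius (k - rank (par t) Y).+1)).
    by apply: radius_le; have := rank_le (par t) Y; lia.
  apply: nearby_trans (IHp _ _ tr (old_state oz)).
  apply: (@spread_bound t (pre t)) py yz; last exact: pinned_B.
  move=> a b ya [_ _ [ab|[X [oa ob]]]]; first by apply: nearby_le ab; apply: leq_addr.
  (* Every absorbed class is no older than [Y], so its rank is at least that of [Y] and its radius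
     at most [R]. *)
  have YX : age Y <= age X by apply: min; exists a.
  have near_X c : old_ t c X -> nearby R c X.2.
    move=> oc; apply: nearby_le (IHp _ _ tr (old_state oc)); apply: radius_le.
    by apply: leq_sub2l; apply: rank_age.
  apply: nearby_le (nearby_trans (near_X _ oa) (nearby_sym (near_X _ ob))).
  exact: leq_addl.
have oy : old_ t y Y.
  apply: comp_pure oz (conn_sym yz) => x q fx oq xq; apply: nx; by exists x, q.
apply: nearby_le (IHp _ _ tr (old_state oy)); apply: radius_le.
by apply: leq_sub2l; apply: rank_par.
Qed.

Lemma state_radius t q X : state t q X -> nearby (radius k) q X.2.
Proof. by move/state_rank_radius; apply: nearby_le; apply: radius_le; apply: leq_subr. Qed.

Lemma new_class_age t q X : old_ t q X -> age (new_ t q) <= age X.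
Proof.
move=> oq; have iX : in_comp_ t q X by exists q => //; apply: Relation_Operators.rt_refl.
by case: (new_classP t (pre t) q) => [[_ /(_ _ iX)]|[_ _ []]] //; exists X.
Qed.

(** Bounds by [k] the class changes of a pinned vertex. Its class can change only if a fresh vertex
    appears near [X], which by [join_drops] requires the death of a class older than [X]. *)
Lemma class_change t q X : old_ t q X -> new_ t q <> X ->
  rank t (new_ t q) < rank (par t) X.
Proof.
move=> oq nX; apply: leq_ltn_trans (rank_age t (new_class_age oq)) _.
have [[x [q' [fx oq' xq]]]|nx] := pselect (exists x q, [/\ fresh_ t x, old_ t q X & nearby r x q]).
  have [|W [aW WX nW]] := join_drops _ fx oq' xq; first by move=> ? ?; apply: state_radius.
  by apply: rank_par_lt aW WX nW; exists q.
case: nX; case: (new_classP t (pre t) q) => [[[y qy oy] _]|[_ _ []]]; last first.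
  by exists X; exists q => //; apply: Relation_Operators.rt_refl.
apply: old_fun oy _; apply: comp_pure oq qy => x q' fx oq' xq.
by apply: nx; exists x, q'.
Qed.

(** * The classes seen by a vertex *)

Definition assoc t v X :=
  (pinned_ t v /\ X = new_ t v) \/
  [/\ B t v, ~ pinned_ t v & exists W q, [/\ covers_ t W v, old_ t q W & X = new_ t q]].

Definition class_at t X := exists q, state t q X.

Lemma assoc_at t v X : assoc t v X -> class_at t X.
Proof.
move=> [[pv ->]|[_ _ [W [q [_ oq ->]]]]]; first by exists v; apply/state_new.
by exists q; apply/state_new; split=> //; left; exists W.
Qed.

Lemma assoc_ex t v : B t v -> exists X, assoc t v X.
Proof.
move=> Bv; have [pv|pv] := pselect (pinned_ t v).
  by exists (new_ t v); left.
have [W cW] : exists W, covers_ t W v.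
  apply: contrapT => nW; apply: (pv); right; split=> // -[X pX].
  by apply: pv; left; exists X.
have [[q oq] _ _] := cW.
by exists (new_ t q); right; split=> //; exists W, q.
Qed.

(** From an unpinned vertex to the center of a cover, on to an old member of that cover, and on to
    the center of that member's new class. *)
Definition assoc_radius := cover_radius + (radius k + radius k).

Lemma assoc_nearby t v X : assoc t v X -> nearby assoc_radius v X.2.
Proof.
move=> [[pv XE]|[_ _ [W [q [[_ _ cW] oq XE]]]]].
  apply: (@nearby_le _ (radius k)); first by rewrite /assoc_radius; lia.
  by apply: (@state_radius t); apply/state_new.
apply: nearby_trans cW _; apply: (@nearby_trans _ _ _ _ q).
  by apply: nearby_sym; apply: state_radius (old_state oq).
by apply: (@state_radius t); apply/state_new; split=> //; left; exists W.
Qed.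

(** This is why the covers of an unpinned vertex only decrease. Being older than the first
    appearance of [v], the class [W] is not born at [par t], so it was inherited there and survived
    as its own successor. *)
Lemma covers_par t v W : covers_ t W v -> B t v -> ~ pinned_ t v -> t <> top v ->
  [/\ t <> root, B (par t) v, ~ pinned_ (par t) v, covers_ (par t) W v
    & assoc (par t) v W].
Proof.
move=> [[q oq] W_top nW] Bv pv tv.
have [tr Bp] := B_par Bv tv.
have ps : ~ pinned_ (par t) v.
  move=> ps; apply: pv; left; exists (new_ (par t) v); split=> //.
  by rewrite pre_par // state_new.
have W1 : W.1 <> par t.
  by move=> W1; have [] := dep_top Bp; rewrite /age W1 in W_top; lia.
have [_ WE] := (state_new _ _ _).1 (old_state oq).
have [|[]] := new_classP (par t) (pre (par t)) q; rewrite -?WE; last by [].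
move=> [[y qy oy] _].
have cW : covers_ (par t) W v by split=> //; exists y.
split=> //; right; split=> //; exists W, y; split=> //.
by rewrite -(conn_new qy).
Qed.

Lemma covers_top t v W : covers_ t W v -> B t v -> ~ pinned_ t v -> t <> top v ->
  assoc (top v) v W.
Proof.
have [n] := ubnP (dep t); elim: n t => // n IH t tn cW Bv pv tv.
have [tr Bp ps cW' aW] := covers_par cW Bv pv tv.
have [<- //|tv'] := pselect (par t = top v).
by apply: (IH (par t)) => //; rewrite (dep_par tr) in tn.
Qed.

(** * Bags of classes *)

Definition slot t X :=
  witness 0 (fun n => exists2 i : 'I_k, i = n :> nat & exists2 q, ball t i q & state t q X).

Lemma slotP t X : class_at t X ->
  exists2 i : 'I_k, i = slot t X :> nat & exists2 q, ball t i q & state t q X.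
Proof.
move=> [q sq]; have [i qi] := (ballP t q).1 (state_B sq).
apply: (@witnessP _ 0 (fun n => exists2 i : 'I_k, i = n :> nat &
  exists2 q, ball t i q & state t q X)).
by exists (i : nat); exists i => //; exists q.
Qed.

Lemma slot_lt t X : class_at t X -> slot t X < k.
Proof. by move=> /slotP [i <- _]. Qed.

Lemma slot_inj t X Y : class_at t X -> class_at t Y -> slot t X = slot t Y -> X = Y.
Proof.
move=> /slotP [i <- [q qi sq]] /slotP [j <- [q' qj sq']] /val_inj ij; subst j.
exact: state_separated sq sq' (ball_nearby qi qj).
Qed.

Lemma class_at_par t X : class_at t X -> X.1 <> t -> t <> root /\ class_at (par t) X.
Proof.
move=> [q /state_birth[[q' oq]|//]] _; split; first exact: old_root oq.
by exists q'; apply: old_state.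
Qed.

Lemma class_at_birth t X : class_at t X -> t <> root -> ~ class_at (par t) X -> X.1 = t.
Proof. by move=> cX tr nX; apply: contrapT => /(class_at_par cX) []. Qed.

(* Every class of t is the heir of at most one class of the parent of t, so that
   a class can be replaced by all its heirs without enlarging the bags. *)
Definition moves t W Y :=
  exists v, [/\ B t v, B (par t) v, assoc (par t) v W & assoc t v Y].
Definition heir t Y W :=
  [/\ t <> root, class_at t Y & (class_at (par t) Y /\ W = Y) \/
  [/\ ~ class_at (par t) Y, exists Z, moves t Z Y & W = witness Y (moves t ^~ Y)]].

Lemma heir_fun t Y W Z : heir t Y W -> heir t Y Z -> W = Z.
Proof. by move=> [_ _ [[c ->]|[c _ ->]]] [_ _ [[c' ->]|[c' _ ->]]]. Qed.

Lemma heir_at t Y W : heir t Y W -> [/\ t <> root, class_at t Y & class_at (par t) W].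
Proof.
move=> [tr cY H]; split=> //; case: H => [[c -> //]|[_ ex ->]].
by have [v [_ _ /assoc_at]] := @witnessP _ Y (moves t ^~ Y) ex.
Qed.

(** The node with second entry [k] stands for [t] itself; the entries below [k] subdivide the edge
    from [t] to its parent. *)
Definition node := (T * 'I_k.+1)%type.
Definition node_root : node := (root, ord0).
Definition node_par (n : node) : node :=
  if n.2 == ord0 then (par n.1, ord_max) else (n.1, inord n.2.-1).
Definition node_dep (n : node) := dep n.1 * k.+1 + n.2.

Lemma node_dep_par n : n <> node_root -> node_dep n = (node_dep (node_par n)).+1.
Proof.
case: n => t i nr; rewrite /node_dep /node_par /=; case: eqP => [i0|i0] /=.
  have tr : t <> root by move=> tr; apply: nr; rewrite tr i0.
  by rewrite i0 (dep_par tr) /=; lia.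
have : i <> 0 :> nat by move=> H; apply: i0; apply: val_inj.
by move=> i1; rewrite inordK; have := ltn_ord i; lia.
Qed.

(* Between the bags of the parent of t and of t, the parent's classes are
   replaced by their heirs one at a time, in the order of their slots. *)
Definition bag (n : node) X :=
  if n.2 == k :> nat then class_at n.1 X else
  (exists2 W, heir n.1 X W & slot (par n.1) W <= n.2) \/
  (n.2 <= slot (par n.1) X /\ exists Y, heir n.1 Y X).

(** The place where [X] enters the bags: the step at which it replaces the class it is heir of, or
    the last node over its birthplace if there is none. *)
Definition top_node X (n : node) := n.1 = X.1 /\
  ((n.2 = k :> nat /\ ~ exists W, heir X.1 X W) \/
   exists2 W, heir X.1 X W & n.2 = slot (par X.1) W :> nat).

Lemma top_node_unique X m n : top_node X m -> top_node X n -> m = n.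
Proof.
move=> [m1 Hm] [n1 Hn]; have E : m.2 = n.2.
  apply: val_inj => /=; case: Hm => [[-> nW]|[W hW ->]]; case: Hn => [[-> nW']|[W' hW' ->]] //.
  - by case: nW; exists W'.
  - by case: nW'; exists W.
  - by rewrite (heir_fun hW hW').
by case: m n m1 n1 E {Hm Hn} => m1 m2 [n1 n2] /= -> -> ->.
Qed.

Lemma node_par_lt t (i : 'I_k.+1) : i <> 0 :> nat ->
  node_par (t, i) = (t, inord i.-1) /\ @inord k i.-1 = i.-1 :> nat.
Proof.
move=> i0; rewrite /node_par /=; case: eqP => [H|_]; first by case: i0; rewrite H.
by split=> //; rewrite inordK; have := ltn_ord i; lia.
Qed.

Lemma bag_par X n : bag n X -> top_node X n \/ (n <> node_root /\ bag (node_par n) X).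
Proof.
have not_root t (i : 'I_k.+1) : t <> root \/ i <> 0 :> nat -> (t, i) <> node_root.
  by move=> H [tr ir]; case: H; [rewrite tr|rewrite ir].
have bag_top t : t <> root -> class_at (par t) X -> bag (node_par (t, ord0)) X.
  by move=> tr cX; rewrite /bag /node_par /= eqxx.
case: n => t i; rewrite {1}/bag /=; case: eqP => [ik|ik].
  move=> cX.
  have [[W hW]|nW] := pselect (exists W, heir t X W); last first.
    have [Xt|Xt] := pselect (X.1 = t).
      by left; split=> //; left; split=> //; rewrite Xt.
    have [tr cX'] := class_at_par cX Xt.
    by case: nW; exists X; split=> //; left.
  have [tr _ /slot_lt cW] := heir_at hW.
  right; split; first by apply: not_root; left.
  have i0 : i <> 0 :> nat by lia.
  have [-> iE] := node_par_lt t i0; rewrite /bag /= iE.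
  case: eqP => [|_]; first by lia.
  by left; exists W => //; lia.
move=> H; have tr : t <> root.
  by case: H => [[W /heir_at[]]|[_ [Y /heir_at[]]]].
have second : class_at (par t) X -> (exists Y, heir t Y X) -> i <= slot (par t) X ->
    (t, i) <> node_root /\ bag (node_par (t, i)) X.
  move=> cX hX iX; split; first by apply: not_root; left.
  have [i0|i0] := pselect (i = 0 :> nat).
    have -> : i = ord0 by apply: val_inj.
    exact: bag_top.
  have [-> iE] := node_par_lt t i0; rewrite /bag /= iE.
  by case: eqP => [|_]; [have := ltn_ord i; lia|right; split=> //; lia].
case: H => [[W hW Wi]|[iX [Y hY]]]; last first.
  by right; apply: second => //; [case: (heir_at hY)|exists Y].
have [Wi'|Wi'] := ltnP (slot (par t) W) i.
  right; split; first by apply: not_root; left.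
  have i0 : i <> 0 :> nat by lia.
  have [-> iE] := node_par_lt t i0; rewrite /bag /= iE.
  by case: eqP => [|_]; [have := ltn_ord i; lia|left; exists W => //; lia].
have iE : i = slot (par t) W :> nat by lia.
have [_ cX _] := hW.
(* This is the step exchanging [W] for [X]. If [X] is new it enters here; otherwise it is its own
   heir and was still waiting to be exchanged. *)
have [cX'|nX] := pselect (class_at (par t) X); last first.
  left; have X1 := class_at_birth cX tr nX.
  by split=> //; right; exists W; rewrite X1.
have hX : heir t X X by split=> //; left.
right; apply: second => //; first by exists X.
by rewrite iE (heir_fun hW hX).
Qed.

(** A labelling showing that bags have at most [k + 1] elements. Exchanged classes use their slot at
    [t], a waiting class borrows the slot of one of its heirs, and the class being exchanged takes
    the extra label [ord_max]. *)
Definition bag_slot (n : node) X : 'I_k.+1 :=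
  if n.2 == k :> nat then inord (slot n.1 X) else
  if pselect (exists2 W, heir n.1 X W & slot (par n.1) W <= n.2) then inord (slot n.1 X) else
  if slot (par n.1) X == n.2 then ord_max else
  inord (slot n.1 (witness X (heir n.1 ^~ X))).

Lemma bag_slot_inj n X Y : bag n X -> bag n Y -> bag_slot n X = bag_slot n Y -> X = Y.
Proof.
have inord_slot t Z Z' : class_at t Z -> class_at t Z' ->
    inord (slot t Z) = inord (slot t Z') :> 'I_k.+1 -> Z = Z'.
  move=> cZ cZ' /(congr1 val); have := slot_lt cZ; have := slot_lt cZ'.
  by move=> zk' zk; rewrite /= !inordK; [exact: slot_inj|lia|lia].
have inord_max t Z : class_at t Z -> inord (slot t Z) <> ord_max :> 'I_k.+1.
  by move=> /slot_lt cZ /(congr1 val) /=; rewrite inordK; lia.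
case: n => t i; rewrite /bag /bag_slot /=; case: eqP => ik; first exact: inord_slot.
have mixed Z Z' : (exists2 W, heir t Z W & slot (par t) W <= i) ->
    ~ (exists2 W, heir t Z' W & slot (par t) W <= i) ->
    i <= slot (par t) Z' /\ (exists V, heir t V Z') ->
    inord (slot t Z) <> (if slot (par t) Z' == i then ord_max else
      inord (slot t (witness Z' (heir t ^~ Z')))) :> 'I_k.+1.
  move=> [W hW Wi] _ [iZ' exV]; have [_ cZ _] := heir_at hW.
  case: eqP => [_|iZ]; first exact: inord_max.
  have hV := @witnessP _ Z' (heir t ^~ Z') exV; have [_ cV _] := heir_at hV.
  move=> /(inord_slot _ _ _ cZ cV) E; rewrite -E in hV.
  by move: iZ iZ' Wi; rewrite (heir_fun hW hV); lia.
case: pselect => [hX|nX]; case: pselect => [hY|nY].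
- move=> _ _; have [[W hW _] [W' hW' _]] := (hX, hY).
  have [[_ cX _] [_ cY _]] := (heir_at hW, heir_at hW'); exact: inord_slot.
- by move=> _ [//|bY] /(mixed _ _ hX nY bY).
- by move=> [//|bX] _ /esym /(mixed _ _ hY nX bX).
move=> [//|[iX exX]] [//|[iY exY]].
have hX := @witnessP _ X (heir t ^~ X) exX; have hY := @witnessP _ Y (heir t ^~ Y) exY.
have [[_ cX' cX] [_ cY' cY]] := (heir_at hX, heir_at hY).
case: eqP => [Xi|nXi]; case: eqP => [Yi|nYi].
- by move=> _; apply: slot_inj cX cY _; rewrite Xi.
- by move/esym/inord_max => /(_ cY').
- by move/inord_max => /(_ cX').
- by move=> /(inord_slot _ _ _ cX' cY') E; rewrite E in hX; apply: heir_fun hX hY.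
Qed.

(** * The graph of classes *)

(** Large enough for both uses: two classes seen by adjacent vertices, and two classes each sharing
    a vertex with a common third, as in [assoc_move]. *)
Definition link_radius := 4 * assoc_radius + 1.

Definition class_vertex := {X : class | exists t, class_at t X}.

Definition class_adj (X Y : class_vertex) :=
  [/\ sval X <> sval Y, nearby link_radius (sval X).2 (sval Y).2
    & exists n, bag n (sval X) /\ bag n (sval Y)].

Lemma class_adj_sym (X Y : class_vertex) : class_adj X Y -> class_adj Y X.
Proof.
move=> [XY nXY [n [bX bY]]]; split; last by exists n.
  by move=> YX; apply: XY.
exact: nearby_sym.
Qed.

Lemma class_adj_irrefl (X : class_vertex) : ~ class_adj X X.
Proof. by case. Qed.

Definition class_graph := Graph class_adj_sym class_adj_irrefl.

Definition at_vertex t X (cX : class_at t X) : class_graph :=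
  exist (fun X => exists t, class_at t X) X (ex_intro _ t cX).

(** Quantifying over all vertices carrying the names spares proofs that the classes occur. It is
    vacuous for a class that never occurs, hence the occurrence of [Y] assumed in
    [class_near_trans]. *)
Definition class_near n X Y := forall X' Y' : class_graph,
  sval X' = X -> sval Y' = Y -> nearby n X' Y'.

Lemma class_vertex_inj (X Y : class_vertex) : sval X = sval Y -> X = Y.
Proof. by case: X Y => [X pX] [Y pY] /= E; subst Y; rewrite (Prop_irrelevance pX pY). Qed.

Lemma class_near_le m n X Y : m <= n -> class_near m X Y -> class_near n X Y.
Proof. by move=> mn H X' Y' X1 Y1; apply: nearby_le mn (H _ _ X1 Y1). Qed.

Lemma class_near_trans m n X Y Z t : class_at t Y ->
  class_near m X Y -> class_near n Y Z -> class_near (m + n) X Z.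
Proof.
move=> cY XY YZ X' Z' X1 Z1.
pose Y' := at_vertex cY.
exact: nearby_trans (XY X' Y' X1 erefl) (YZ Y' Z' erefl Z1).
Qed.

Lemma class_near_bag X Y n : bag n X -> bag n Y -> nearby link_radius X.2 Y.2 ->
  class_near 1 X Y.
Proof.
move=> bX bY XY X' Y' X1 Y1.
have [E|nE] := pselect (X = Y); last first.
  have XY' : class_adj X' Y' by split; rewrite X1 Y1 //; exists n.
  exact: (@nearby_adj class_graph).
have -> : X' = Y' by apply: class_vertex_inj; rewrite X1 Y1.
exact: nearby_refl.
Qed.

Lemma bag_at t X : class_at t X <-> bag (t, ord_max) X.
Proof. by rewrite /bag /= eqxx. Qed.

Lemma assoc_near t u v X Y : nearby 1 u v -> assoc t u X -> assoc t v Y ->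
  class_near 1 X Y.
Proof.
move=> uv aX aY; apply: (@class_near_bag _ _ (t, ord_max)).
- exact/bag_at/(assoc_at aX).
- exact/bag_at/(assoc_at aY).
apply: nearby_le (nearby_trans (nearby_sym (assoc_nearby aX))
  (nearby_trans uv (assoc_nearby aY))).
by rewrite /link_radius; lia.
Qed.

(** If [Y] occurs at the parent, it shares that bag with [X]. Otherwise pass through the class [W]
    whose heir is [Y]: it meets [X] at the parent, and [Y] in the bag where the two are
    exchanged. *)
Lemma assoc_move t v X Y : t <> root -> B t v -> B (par t) v ->
  assoc (par t) v X -> assoc t v Y -> class_near 2 X Y.
Proof.
move=> tr Bv Bp aX aY; have [cX cY] := (assoc_at aX, assoc_at aY).
have rXY : nearby (assoc_radius + assoc_radius) X.2 Y.2.
  exact: nearby_trans (nearby_sym (assoc_nearby aX)) (assoc_nearby aY).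
have [cY'|nY] := pselect (class_at (par t) Y).
  apply: (@class_near_le 1) => //.
  apply: (@class_near_bag _ _ (par t, ord_max)); [exact/bag_at|exact/bag_at|].
  by apply: nearby_le rXY; rewrite /link_radius; lia.
have exm : exists Z, moves t Z Y by exists X, v.
have mW := @witnessP _ Y (moves t ^~ Y) exm; set W := witness _ _ in mW.
have hW : heir t Y W by split=> //; right.
have [_ _ cW] := heir_at hW; have sW := slot_lt cW.
have [w [_ _ aW aY']] := mW.
have rWY : nearby (assoc_radius + assoc_radius) W.2 Y.2.
  exact: nearby_trans (nearby_sym (assoc_nearby aW)) (assoc_nearby aY').
apply: (@class_near_trans 1 1 X W Y _ cW).
  apply: (@class_near_bag _ _ (par t, ord_max)); [exact/bag_at|exact/bag_at|].
  by apply: nearby_le (nearby_trans rXY (nearby_sym rWY)); rewrite /link_radius; lia.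
have iE : @inord k (slot (par t) W) = slot (par t) W :> nat by rewrite inordK; lia.
apply: (@class_near_bag _ _ (t, inord (slot (par t) W))).
- by rewrite /bag /= iE; case: eqP => [|_]; [lia|right; split=> //; exists Y].
- by rewrite /bag /= iE; case: eqP => [|_]; [lia|left; exists W].
by apply: nearby_le rWY; rewrite /link_radius; lia.
Qed.

(** The cover behind [Y] is itself seen both at [top v] and at [par t], so one step and one move
    suffice. *)
Lemma assoc_unpinned t v X Y : B t v -> ~ pinned_ t v ->
  assoc (top v) v X -> assoc t v Y -> class_near 3 X Y.
Proof.
move=> Bv pv aX aY; have [tv|tv] := pselect (t = top v).
  rewrite tv in aY; apply: (@class_near_le 1) => //.
  exact: assoc_near (nearby_refl _ _) aX aY.
have [W [q [cW _ _]]] : exists W q, [/\ covers_ t W v, old_ t q W & Y = new_ t q].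
  by case: aY => [[/pv]|[]].
have [tr Bp _ _ aW] := covers_par cW Bv pv tv.
apply: (@class_near_trans 1 2 X W Y _ (assoc_at aW)).
  exact: assoc_near (nearby_refl _ _) aX (covers_top cW Bv pv tv).
exact: assoc_move aW aY.
Qed.

(** The unpinned phase costs 3 and the move that pins the vertex 2, within the constant 6; each of
    at most [k] class changes costs 2. *)
Definition drift := 6 + 2 * k.

Lemma assoc_drift t v X Y : B t v -> assoc (top v) v X -> assoc t v Y ->
  class_near drift X Y.
Proof.
have main s Z : B s v -> pinned_ s v -> assoc (top v) v X -> Z = new_ s v ->
    class_near (6 + 2 * (k - rank s Z)) X Z.
  have [n] := ubnP (dep s); elim: n s Z => // n IH s Z sn Bs ps aX ZE.
  have aZ : assoc s v Z by left.
  have [sv|sv] := pselect (s = top v).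
    rewrite sv in aZ; apply: (@class_near_le 1); first by lia.
    exact: assoc_near (nearby_refl _ _) aX aZ.
  have [sr Bp] := B_par Bs sv.
  have [pp|pp] := pselect (pinned_ (par s) v); last first.
    have [W aW] := assoc_ex Bp.
    apply: (@class_near_le (3 + 2)); first by lia.
    apply: class_near_trans (assoc_at aW) _ (assoc_move sr Bs Bp aW aZ).
    exact: assoc_unpinned Bp pp aX aW.
  have aW : assoc (par s) v (new_ (par s) v) by left.
  set W := new_ (par s) v in aW.
  have IHW : class_near (6 + 2 * (k - rank (par s) W)) X W.
    by apply: IH => //; rewrite (dep_par sr) in sn.
  have oW : old_ s v W by split=> //; rewrite pre_par // state_new.
  (* Keeping the class costs nothing; changing it costs one move, paid by the drop in rank. *)
  have [ZW|ZW] := pselect (Z = W).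
    rewrite ZW; apply: class_near_le IHW; have aliveW : alive_ s W by exists v.
    by have := rank_par aliveW; lia.
  have lt : rank s Z < rank (par s) W.
    by rewrite ZE; apply: class_change oW _; rewrite -ZE.
  have := class_near_trans (assoc_at aW) IHW (assoc_move sr Bs Bp aW aZ).
  by apply: class_near_le; have := rank_le (par s) W; lia.
move=> Bv aX aY; have [pv|pv] := pselect (pinned_ t v); last first.
  by apply: class_near_le (assoc_unpinned Bv pv aX aY); rewrite /drift; lia.
have YE : Y = new_ t v by case: aY => [[]//|[_ /(_ pv)]].
by apply: class_near_le (main _ _ Bv pv aX YE); rewrite /drift; lia.
Qed.

Lemma class_graph_near n (X Y : class_graph) : nearby n X Y ->
  nearby (n * link_radius) (sval X).2 (sval Y).2.
Proof.
move=> [p + pn]; elim: p n X pn => [|Z p IH] n X pn /=.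
  by move=> ->; apply: nearby_refl.
case: n pn => // n pn [[_ XZ _] wp]; rewrite mulSn.
by apply: nearby_trans XZ _; apply: IH wp.
Qed.

Lemma class_graph_vertices (X : class_graph) : exists n, bag n (sval X).
Proof. by case: X => X [t cX]; exists (t, ord_max); apply/bag_at. Qed.

Lemma class_graph_edges (X Y : class_graph) : adj X Y ->
  exists n, bag n (sval X) /\ bag n (sval Y).
Proof. by case. Qed.

Lemma class_graph_inter (n1 n2 n3 : parent_graph node_dep_par) p :
  is_path n1 p n3 -> List.In n2 (n1 :: p) ->
  ([set X : class_graph | bag n1 (sval X)] `&` [set X : class_graph | bag n3 (sval X)]
   `<=` [set X : class_graph | bag n2 (sval X)])%classic.
Proof.
move=> Pp np X [b1 b3].
pose m := witness node_root (top_node (sval X)).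
apply: (@parent_graph_convex _ _ _ _ node_dep_par (bag ^~ (sval X)) m) Pp np b1 b3.
move=> n bn nm; case: (bag_par bn) => // tn; case: nm.
apply: top_node_unique (tn) _; exact: (@witnessP _ node_root (top_node (sval X)) (ex_intro _ n tn)).
Qed.

Definition class_decomposition : tree_decomposition class_graph :=
  @TreeDecomposition class_graph (parent_graph node_dep_par)
    (fun n => [set X : class_graph | bag n (sval X)]%classic)
    (parent_graph_tree node_dep_par) class_graph_vertices class_graph_edges
    class_graph_inter.

Hypothesis B_edge : forall u v, adj u v -> exists t, B t u /\ B t v.

(** The map sends [v] to a class seen at [top v]. By [assoc_drift] this can be compared with any
    other bag containing [v], in particular one containing an edge at [v]. *)
Lemma class_graph_map : exists phi : G -> class_graph,
  [/\ forall u v, adj u v -> nearby (drift + (1 + drift)) (phi u) (phi v),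
      forall n u v, nearby n (phi u) (phi v) ->
        nearby (n * link_radius + (assoc_radius + assoc_radius)) u v
    & forall Y : class_graph, exists v, nearby drift (phi v) Y].
Proof.
have /choice [phi phiP] : forall v, exists X : class_graph, assoc (top v) v (sval X).
  move=> v; have [X aX] := assoc_ex (B_top v).
  by exists (at_vertex (assoc_at aX)).
exists phi; split.
- move=> u v uv; have [t [Bu Bv]] := B_edge uv.
  have [[X aX] [Y aY]] := (assoc_ex Bu, assoc_ex Bv).
  pose X' := at_vertex (assoc_at aX).
  pose Y' := at_vertex (assoc_at aY).
  have H1 : nearby drift (phi u) X' := assoc_drift Bu (phiP u) aX (Y' := X') erefl erefl.
  have H2 : nearby 1 X' Y' := assoc_near (nearby_adj uv) aX aY (X' := X') (Y' := Y') erefl erefl.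
  have H3 : nearby drift (phi v) Y' := assoc_drift Bv (phiP v) aY (Y' := Y') erefl erefl.
  exact: nearby_trans H1 (nearby_trans H2 (nearby_sym H3)).
- move=> n u v /class_graph_near uv.
  apply: nearby_le (nearby_trans (assoc_nearby (phiP u))
    (nearby_trans uv (nearby_sym (assoc_nearby (phiP v))))); lia.
move=> Y'; have [t [q sq]] := svalP Y'; exists q; have [pq YE] := (state_new _ _ _).1 sq.
have aY : assoc t q (sval Y') by left.
exact: (assoc_drift (state_B sq) (phiP q) aY (Y' := Y') erefl erefl).
Qed.

End Process.

(** * Tree-width, quasi-isometry and constants *)

Section Conclusion.
Local Open Scope ring_scope.

Lemma counting_le (R : realType) (X : choiceType) (A : set X) n (f : X -> 'I_n) :
  (forall x y, A x -> A y -> f x = f y -> x = y) -> (counting A <= n%:R%:E :> \bar R)%E.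
Proof.
move=> finj.
have bd (S : {fset X}) : ([set` S] `<=` A)%classic -> (#|` S| <= n)%N.
  move=> SA; rewrite cardfE; have := @leq_card S 'I_n (f \o val).
  rewrite card_ord; apply=> x y /= xy; apply: val_inj; apply: finj xy.
    by apply: SA; exact: (valP x).
  by apply: SA; exact: (valP y).
have finA : finite_set A.
  apply: contrapT => /(infinite_set_fset n.+1) [S SA]; rewrite ltnNge.
  by rewrite bd.
rewrite /counting asboolT // lee_fin ler_nat; apply: bd.
by rewrite fset_setK.
Qed.

Lemma treewidth_le (R : realType) (H : graph) (D : tree_decomposition H) k
    (f : td_tree D -> H -> 'I_k.+1) :
  (forall t x y, td_bag D t x -> td_bag D t y -> f t x = f t y -> x = y) ->
  (treewidth R H <= k%:R%:E)%E.
Proof.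
move=> finj; apply: (@le_trans _ _ (td_width R D)).
  by apply: ereal_inf_lbound; exists D.
apply: ge_ereal_sup => _ [t ->].
rewrite leeBlDr // -EFinD natr1.
exact: (@counting_le R {classic H} _ k.+1 (f t) (finj t)).
Qed.

Lemma quasi_isometry_nearby (R : realType) (G H : graph) (phi : G -> H) (a b c d : nat) :
  (forall u v, adj u v -> nearby a (phi u) (phi v)) ->
  (forall n u v, nearby n (phi u) (phi v) -> nearby (n * b + c) u v) ->
  (forall y, exists v, nearby d (phi v) y) ->
  quasi_isometry ((a + b).+1%:R : R) (c + d).+1%:R phi.
Proof.
move=> pa pb pd.
have up n u v : nearby n u v -> nearby (n * a) (phi u) (phi v).
  move=> [p + pn]; elim: p n u pn => [|w p IH] n u pn /=.
    by move=> ->; apply: nearby_refl.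
  case: n pn => // n pn [uw wp]; rewrite mulSn.
  by apply: nearby_trans (pa _ _ uw) _; apply: IH wp.
split=> [u v /dist_fin_num [n -> /up uv]|u v /dist_fin_num [n -> /pb uv]|y].
- rewrite -EFinM -natrM -EFinD -natrD; apply: nearby_dist_le.
  by apply: nearby_le uv; lia.
- rewrite -EFinM -natrM -EFinD -natrD; apply: nearby_dist_le.
  by apply: nearby_le uv; lia.
have [v vy] := pd y; exists v; apply: nearby_dist_le; apply: nearby_le vy; lia.
Qed.

Lemma union_of_small_balls (R : realType) (G : graph) k (r : R) n (A : set G) :
  r < n%:R -> union_of_small k r A ->
  exists ball : 'I_k -> G -> Prop, (forall v, A v <-> exists i, ball i v) /\
    forall i u v, ball i u -> ball i v -> nearby n u v.
Proof.
move=> rn [m [X [mk -> dX]]].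
(* The family of [m] sets is padded with empty sets to exactly [k]. *)
exists (fun i v => exists2 j : 'I_m, j = i :> nat & X j v); split=> [v|i u v].
  split=> [[j _ Xv]|[i [j _ Xv]]]; last by exists j.
  by exists (widen_ord mk j), j.
move=> [j ji Xu] [j' ji' Xv]; have jj : j = j' by apply: ord_inj; rewrite ji ji'.
subst j'; apply: dist_le_nearby rn; apply: le_trans (dX j).
by apply: ereal_sup_ubound; exists u, v.
Qed.

End Conclusion.

Local Open Scope ring_scope.

Theorem mainTheorem1 (R : realType) (k : nat) (r : R) (hr : 0 <= r) :
  exists L C : R, 1 <= L /\ 1 <= C /\
    forall G : graph,
      (exists D : tree_decomposition G,
          forall t : td_tree D, union_of_small k r (td_bag D t)) ->
      exists H : graph,
        (treewidth R H <= k%:R%:E)%E /\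
        exists phi : G -> H, quasi_isometry L C phi.
Proof.
(* The integer [n] replaces [r] throughout the scan, so the constants depend only on [k] and [r];
   the successors make them at least 1. *)
pose n := Num.bound r; have rn : r < n%:R by apply: archi_boundP.
exists (drift k + (1 + drift k) + link_radius k n).+1%:R,
  (assoc_radius k n + assoc_radius k n + drift k).+1%:R.
split; first by rewrite ler1n.
split; first by rewrite ler1n.
move=> G [D smallD].
have [root [par [dep [dep_root dep_par tops]]]] := tree_root (td_is_tree D).
have /choice [ball ballE] := fun t => union_of_small_balls rn (smallD t).
have ballP t := (ballE t).1; have ball_near t := (ballE t).2.
(* The nodes whose bags contain [v] form a nonempty convex set, and [top v] is its topmost node. *)
have /choice [top topP] : forall v, exists m, td_bag D m v /\
    forall t, td_bag D t v -> t <> m -> t <> root /\ td_bag D (par t) v.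
  move=> v; have [||m mv mP] := tops (fun t => td_bag D t v); last by exists m.
    by move=> t1 t2 t3 p Pp tp v1 v3; apply: (td_inter Pp tp).
  exact: td_vertices.
have B_top v := (topP v).1.
have B_par t v := (topP v).2 t.
pose DH := class_decomposition n top dep_root dep_par ballP.
have [phi [p1 p2 p3]] :=
  class_graph_map dep_root dep_par ballP ball_near B_top B_par (@td_edges _ D).
exists (class_graph root par dep n (td_bag D) ball top); split; last first.
  exists phi; exact: quasi_isometry_nearby p1 p2 p3.
apply: (@treewidth_le R _ DH k
  (fun t X => bag_slot root par dep n (td_bag D) ball top t (sval X))) => t X Y bX bY XY.
apply: class_vertex_inj.
exact: (bag_slot_inj (n := t) (X := sval X) (Y := sval Y) dep_root ballP ball_near bX bY XY).
Qed.
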